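(* For every integer $K \ge 2$ one has $N_2(K) \leq 2K(K+1)+1$; that is, for every $K\ge 2$ there exists a nontrivial $K$-multimagic square of order $2K(K+1)+1$.
   Context: An $N\times N$ integer matrix is a magic square of order $N$ if the sums of the entries in each of its $N$ rows, each of its $N$ columns, and each of its two main diagonals (the entries $z_{i,i}$ and the entries $z_{i,N+1-i}$) are all equal. For $K \ge 2$, a matrix ${\mathbf Z}=(z_{i,j})\in\mathbb{Z}^{N\times N}$ is a $K$-multimagic square of order $N$ (an MMS$(K,N)$) if for every $1\le k\le K$ the matrix $(z_{i,j}^k)_{1\le i,j\le N}$ is a magic square. An MMS$(K,N)$ is called trivial if its entries take $N$ or fewer distinct integer values, and nontrivial otherwise. $N_2(K)$ denotes the smallest positive integer $N$ for which there exists a nontrivial MMS$(K,N)$. *)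

(* Defs.v *)
From mathcomp Require Import all_boot all_order all_algebra.

Set Implicit Arguments.
Unset Strict Implicit.
Unset Printing Implicit Defensive.

Import GRing.Theory.
Local Open Scope ring_scope.

(* Indices are 0-based: [rev_ord i] has value N - 1 - i, so the entries
   [Z i (rev_ord i)] form the second main diagonal z_{i,N+1-i}. *)
Definition magic_square (N : nat) (Z : 'M[int]_N) : Prop :=
  exists s : int,
    [/\ forall i : 'I_N, \sum_(j < N) Z i j = s,
        forall j : 'I_N, \sum_(i < N) Z i j = s,
        \sum_(i < N) Z i i = s
      & \sum_(i < N) Z i (rev_ord i) = s].

(* The powers are entrywise, not matrix powers. *)
Definition multimagic_square (K N : nat) (Z : 'M[int]_N) : Prop :=
  forall k : nat, (1 <= k <= K)%N ->
    magic_square (map_mx (fun z : int => z ^+ k) Z).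

Definition entry_values (N : nat) (Z : 'M[int]_N) : seq int :=
  undup [seq Z p.1 p.2 | p : 'I_N * 'I_N].

Definition trivial_square (N : nat) (Z : 'M[int]_N) : Prop :=
  (size (entry_values Z) <= N)%N.

Definition has_nontrivial_MMS (K N : nat) : Prop :=
  exists Z : 'M[int]_N, multimagic_square K Z /\ ~ trivial_square Z.

(* [is_N2 K n] says that N_2(K) is defined and equal to n. *)
Definition is_N2 (K n : nat) : Prop :=
  [/\ (0 < n)%N, has_nontrivial_MMS K n
    & forall m : nat, (0 < m)%N -> has_nontrivial_MMS K m -> (n <= m)%N].

(* Main.v *)
Require Import Defs.
From mathcomp Require Import all_boot all_order all_algebra.
From mathcomp Require Import zify ring.
From Stdlib Require Import Classical.

(** Let [n = K(K+1)/2], so that the order is [N = 4n+1].  By the pigeonhole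
    principle, for every [m > n] there are distinct [m]-element sets of integers
    [f] and [g] with equal [k]-th power sums for [1 <= k <= K].  Take a Latin
    square of order [N] whose two main diagonals are transversals and which has
    a Latin subsquare of order [m] that meets the main diagonal in a transversal
    and misses the antidiagonal, fill the cells with [N] distinct integers
    so that the subsquare carries [f], and replace [f] by [g] inside the
    subsquare: all line power sums are kept, and at least one new value
    appears.

    The Latin square, with [m = 2h] and [u = N - 2h >= 4h + 3] coprime to 6, is the
    prolongation of the square [3i - j] over [Z/u] along the transversals
    [j = i + 2s] for [s] in [S = {-h..-1, 1..h}].  Its rows and columns are
    indexed by [Z/u + S]; the antidiagonal is the graph of the involution that
    is [i |-> -i] on [Z/u] outside [W = {h+2 <= |i| <= 2h+1}] and exchanges [W]
    with [S].  This covers [K >= 4], and [K = 3] with an explicit pair of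
    6-element sets; for [K = 2] no suitable [h] exists, and a square of order 13
    is given. *)

Set Implicit Arguments.
Unset Strict Implicit.
Unset Printing Implicit Defensive.

Import GRing.Theory.
Local Open Scope ring_scope.

(** * Distinct integer sets with equal power sums *)

Lemma pigeonhole_fiber (T : finType) (A : {set T}) (phi : T -> nat) (b : nat) :
  (forall x, phi x < b)%N -> exists2 B : {set T}, B \subset A &
    {in B &, forall x y, phi x = phi y} /\ (#|A| <= #|B| * b)%N.
Proof.
move=> phi_lt; case: b phi_lt => [|b] phi_lt.
  exists A => //; split=> [x|]; first by have := phi_lt x.
  rewrite muln0 leqn0 cards_eq0; apply/eqP/setP => x.
  by have := phi_lt x.
pose fib (v : 'I_b.+1) := [set x in A | phi x == v].
case: (@arg_maxnP _ ord0 xpredT (fun v => #|fib v|) isT) => v0 _ v0_max.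
exists (fib v0); first by apply/subsetP => x; rewrite inE => /andP[].
split=> [x y|]; first by rewrite !inE => /andP[_ /eqP->] /andP[_ /eqP->].
have -> : #|A| = (\sum_v #|fib v|)%N.
  rewrite -sum1_card (partition_big (fun x => Ordinal (phi_lt x)) predT) //=.
  apply: eq_bigr => v _; rewrite sum1dep_card; apply: eq_card => x.
  by rewrite !inE.
rewrite mulnC -[X in (_ <= X * _)%N](card_ord b.+1) -sum_nat_const.
apply: leq_sum => v _.
exact: v0_max.
Qed.

Lemma equal_power_sums (K m : nat) : ('C(K.+1, 2) < m)%N ->
  exists f g : 'I_m -> nat,
  [/\ injective f, exists s0, forall s, f s != g s0 &
      forall k, (1 <= k <= K)%N -> (\sum_s f s ^ k = \sum_s g s ^ k)%N].
Proof.
move=> Km.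
(* The [k]-th power sum is at most [m (mM)^k], hence below [(m^(k+1) + 1) M^k]. [D] collects the
   constants, and [M > D K] makes [M ^ m] exceed the number of power-sum vectors. *)
pose D n := (\prod_(1 <= k < n.+1) (m ^ k.+1).+1)%N; pose M := (D K).+1.
(* The [i]-th value lies in the [i]-th block of length [M], so [val_ p] is injective and values of
   [p] and [q] can agree only at equal indices. *)
pose val_ (p : {ffun 'I_m -> 'I_M}) (i : 'I_m) := (i * M + p i)%N.
(* At most [D n * M ^ 'C(n.+1, 2)] vectors of the first [n] power sums occur. *)
have /(_ K)[A AK cardA] n : exists2 A : {set {ffun 'I_m -> 'I_M}},
    {in A &, forall p q k, (1 <= k <= n)%N ->
       (\sum_i val_ p i ^ k = \sum_i val_ q i ^ k)%N}
    & (M ^ m <= #|A| * (D n * M ^ 'C(n.+1, 2)))%N.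
  elim: n => [|n [A AK cardA]].
    exists setT => [p q _ _ k|]; first by lia.
    by rewrite cardsT card_ffun !card_ord /D big_geq // bin_small // !muln1.
  have [p|B BA [BK cardB]] :=
      @pigeonhole_fiber _ A (fun p => \sum_i val_ p i ^ n.+1)%N
        ((m ^ n.+2).+1 * M ^ n.+1)%N.
    have : (\sum_i val_ p i ^ n.+1 <= \sum_(i < m) (m * M) ^ n.+1)%N.
      apply: leq_sum => i _; rewrite leq_exp2r //.
      apply: (@leq_trans (i.+1 * M)); last by rewrite leq_mul2r ltn_ord orbT.
      by rewrite /val_ mulSn addnC leq_add2r ltnW.
    move/leq_ltn_trans; apply; rewrite sum_nat_const card_ord expnMn mulnA -expnS.
    by rewrite mulSn -[X in (X < _)%N]add0n ltn_add2r expn_gt0.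
  exists B => [p q pB qB k /andP[k0]|].
    rewrite leq_eqVlt ltnS => /orP[/eqP->|kn]; first exact: BK.
    by apply: AK; rewrite ?k0 ?(subsetP BA).
  rewrite /D big_nat_recr //= -/(D n) binS bin1 expnD.
  apply: leq_trans cardA _.
  apply: leq_trans (leq_mul cardB (leqnn _)) _.
  by apply: eq_leq; ring.
have D0 : (0 < D K)%N by rewrite /D prodn_gt0.
have /card_gt1P[p [q [pA qA pq]]] : (1 < #|A|)%N.
  rewrite ltnNge; apply/negP => A1.
  have : (M ^ m <= D K * M ^ 'C(K.+1, 2))%N.
    by apply: leq_trans cardA _; rewrite -[leqRHS]mul1n leq_mul2r A1 orbT.
  apply/negP; rewrite -ltnNge.
  apply: (@leq_trans (M * M ^ 'C(K.+1, 2))); last by rewrite -expnS leq_exp2l.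
  by rewrite ltn_mul2r expn_gt0 /= /M ltnSn.
have val_divn r i : (val_ r i %/ M = i)%N.
  by rewrite /val_ divnMDl // divn_small ?addn0.
exists (val_ p), (val_ q); split; last by move=> k kK; apply: AK.
  by move=> i j /(congr1 (divn^~ M)); rewrite !val_divn => /val_inj.
have [s0 ps0] : exists s0, p s0 != q s0.
  apply/existsP; rewrite -negb_forall; apply: contra pq => /forallP pq.
  by apply/eqP/ffunP => s; apply/eqP.
exists s0 => s; apply: contra ps0 => /eqP E.
have s_s0 : s = s0.
  by apply: val_inj; move: (congr1 (divn^~ M) E); rewrite !val_divn.
by apply/eqP/val_inj; move: E; rewrite /val_ s_s0 => /addnI.
Qed.

(** * Auxiliary Latin squares and the indexing of the antidiagonal *)

Lemma eq_card_bij (S T : finType) : #|S| = #|T| ->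
  exists F : S -> T, bijective F.
Proof.
move=> E; exists (fun x => enum_val (cast_ord E (enum_rank x))).
exists (fun y => enum_val (cast_ord (esym E) (enum_rank y))) => x.
  by rewrite enum_valK cast_ordK enum_rankK.
by rewrite enum_valK cast_ordKV enum_rankK.
Qed.

Lemma latin_option_with_transversal (R : finComNzRingType) :
  injective (fun x : R => 2%:R * x) ->
  exists Q : option R -> option R -> option R,
  [/\ forall a, injective (Q a), forall b, injective (Q^~ b) &
      injective (fun a => Q a a)].
Proof.
move=> reg2.
(* The square [x + y], prolonged along the transversal [y = x + 1]. *)
pose Q (a b : option R) : option R :=
  match a, b with
  | Some x, Some y => if y == x + 1 then None else Some (x + y)
  | Some x, None => Some (2%:R * x + 1)
  | None, Some y => Some (2%:R * y - 1)
  | None, None => None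
  end.
have QL a : injective (Q a).
  case: a => [x|] [y|] [y'|] //=.
  - case: eqP => [->|ny]; case: eqP => [->|ny'] //.
    by move=> /Some_inj/addrI->.
  - case: eqP => // ny /Some_inj E; case: ny.
    have -> : y = (x + y) - x by ring.
    by rewrite E; ring.
  - case: eqP => // ny /Some_inj E; case: ny.
    have -> : y' = (x + y') - x by ring.
    by rewrite -E; ring.
  - by move=> /Some_inj/addIr/reg2->.
have QR b : injective (Q^~ b).
  case: b => [y|] [x|] [x'|] //=.
  - case: eqP => [->|nx]; case: eqP => [E|nx'] //; first by rewrite (addIr _ E).
    by move=> /Some_inj/addIr->.
  - case: eqP => // nx /Some_inj E; case: nx.
    have -> : x = (x + y) - y by ring.
    by rewrite E; ring.
  - case: eqP => // nx /Some_inj E; case: nx.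
    have -> : x' = (x' + y) - y by ring.
    by rewrite -E; ring.
  - by move=> /Some_inj/addIr/reg2->.
have QD : injective (fun a => Q a a).
  have neq x : (x == x + 1 :> R) = false.
    by rewrite -{1}[x]addr0 (inj_eq (addrI x)) eq_sym oner_eq0.
  have dbl (x : R) : x + x = 2%:R * x by ring.
  by move=> [x|] [x'|] //=; rewrite ?neq // !dbl => /Some_inj/reg2->.
by exists Q.
Qed.

(** The order [q = #|S| - 1] is odd, so doubling is injective in ['Z_q]; [2 < #|S|] ensures that
    ['Z_q] really has [q] elements. *)
Lemma latin_square_with_transversal (S : finType) :
  (2 < #|S|)%N -> ~~ odd #|S| -> exists P : S -> S -> S,
  [/\ forall x, injective (P x), forall y, injective (P^~ y) &
      injective (fun x => P x x)].
Proof.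
move=> S3 evS; pose q := #|S|.-1.
have q1 : (1 < q)%N by rewrite /q; lia.
have reg2 : injective (fun x : 'Z_q => 2%:R * x).
  apply: mulrI; rewrite unitZpE // coprimen2 /q; lia.
have [Q [QL QR QD]] := latin_option_with_transversal reg2.
have [F [G FK GK]] : exists F : S -> option 'Z_q, bijective F.
  have E : #|S| = #|{: option 'Z_q}|.
    by rewrite card_option card_ord Zp_cast // /q; lia.
  exact: eq_card_bij.
have [Finj Ginj] := (can_inj FK, can_inj GK).
exists (fun x y => G (Q (F x) (F y))); split.
- by move=> x y y' /Ginj/QL/Finj.
- by move=> y x x' /Ginj/QR/Finj.
- by move=> x x' /Ginj/QD/Finj.
Qed.

(** Involutions with exactly one fixed point on sets of equal size are conjugate, and [rev_ord] for
    odd [N] is one; so the graph of [sigma] can serve as the antidiagonal. *)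
Lemma antidiagonal_indexing (I : finType) (sigma : I -> I) (c : I) (N : nat) :
  #|I| = N -> involutive sigma -> (forall x, (sigma x == x) = (x == c)) ->
  exists2 phi : 'I_N -> I, bijective phi &
    forall i, phi (rev_ord i) = sigma (phi i).
Proof.
move=> cardI sK fixE.
(* [l] contains one element of each 2-cycle of [sigma]. *)
pose l := [seq x <- enum I | enum_rank x < enum_rank (sigma x)]%N.
(* Partners sit at mirrored positions around [c], so reversing [s] amounts to applying [sigma]. *)
pose s := l ++ c :: rev (map sigma l).
have sc : sigma c = c by apply/eqP; rewrite fixE.
have mem_l x : (x \in l) = (enum_rank x < enum_rank (sigma x))%N.
  by rewrite mem_filter mem_enum andbT.
have mem_sl x : (x \in map sigma l) = (enum_rank (sigma x) < enum_rank x)%N.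
  by rewrite -{1}[x]sK (mem_map (can_inj sK)) mem_l sK.
have all_s x : x \in s.
  rewrite mem_cat inE mem_rev mem_sl mem_l -fixE.
  case: ltngtP => [_|_|/val_inj/enum_rank_inj Ex]; rewrite ?orbT //=.
  by rewrite -Ex eqxx.
have uniq_l : uniq l by rewrite filter_uniq ?enum_uniq.
have uniq_s : uniq s.
  rewrite cat_uniq uniq_l /= rev_uniq (map_inj_uniq (can_inj sK)) uniq_l andbT.
  rewrite mem_rev mem_sl sc ltnn negb_or mem_l sc ltnn /= andbT.
  apply/hasPn => x; rewrite mem_rev mem_sl mem_l; lia.
have size_s : size s = N.
  rewrite -cardI -(card_uniqP uniq_s); apply: eq_card => x.
  by rewrite all_s.
have rev_s : rev s = map sigma s.
  rewrite /s rev_cat rev_cons revK map_cat /= map_rev sc (mapK sK).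
  by rewrite cat_rcons.
exists (fun i => nth c s i); last first.
  move=> i; rewrite -(nth_map c c) ?size_s // -rev_s nth_rev ?size_s //.
apply: inj_card_bij; last by rewrite cardI card_ord.
move=> i j /eqP; rewrite nth_uniq ?size_s // => /eqP; exact: val_inj.
Qed.

(** * The prolonged Latin square and its two diagonals *)

Section Prolongation.

Variables (R : finComNzRingType) (S : finType) (e w : S -> R).
Variables (nu tau rho : S -> S) (P : S -> S -> S).

Hypothesis reg2 : injective (fun x : R => 2%:R * x).
Hypothesis reg3 : injective (fun x : R => 3%:R * x).
Hypothesis e_inj : injective e.
Hypothesis w_inj : injective w.
Hypothesis tau_inj : injective tau.
Hypothesis rho_inj : injective rho.
Hypothesis e_neq0 : forall s, e s != 0.
Hypothesis w_neq0 : forall s, w s != 0.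
Hypothesis e_neq_w : forall s t, e s != w t.
Hypothesis e_nu : forall s, e (nu s) = - e s.
Hypothesis w_nu : forall s, w (nu s) = - w s.
Hypothesis w_tau : forall s, w s - 3%:R * e s = 2%:R * w (tau s).
Hypothesis w_rho : forall s, w s + e s = 2%:R * e (rho s).
Hypothesis P_row : forall s, injective (P s).
Hypothesis P_col : forall t, injective (P^~ t).
Hypothesis P_diag : injective (fun s => P s s).

(* [inl] indexes the rows, columns and symbols of [Z/u]; [inr s] is the symbol
   put on the transversal [j = i + 2 e s], the row receiving the entries
   displaced from it, and the column receiving those displaced from the
   transversal of [- e s]. *)
Definition prolongation (x y : R + S) : R + S :=
  match x, y with
  | inl i, inl j =>
      if [pick s | j - i == 2%:R * e s] is Some s then inr s
      else inl (3%:R * i - j)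
  | inr s, inl j => inl (2%:R * j - 6%:R * e s)
  | inl i, inr t => inl (2%:R * i + 2%:R * e t)
  | inr s, inr t => inr (P s t)
  end.

Definition antidiag (x : R + S) : R + S :=
  match x with
  | inl i => if [pick s | w s == i] is Some s then inr s else inl (- i)
  | inr s => inl (w s)
  end.

Lemma prolongation_row x : injective (prolongation x).
Proof using reg2 e_inj e_nu P_row.
(* An entry [3i - j] equal to the one in column [inr t] would lie on the transversal of [- e t],
   whose cells hold symbols of [S]. *)
have off i j t : j - i <> 2%:R * e (nu t) ->
    3%:R * i - j = 2%:R * i + 2%:R * e t -> False.
  move=> ne E; case: ne; rewrite e_nu.
  have -> : j - i = 2%:R * i - (3%:R * i - j) by ring.
  by rewrite E; ring.
case: x => [i|s] [j|t] [j'|t'] //=.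
- case: pickP => [s /eqP Es|Ns]; case: pickP => [s' /eqP Es'|Ns'] //.
    by case=> ss'; rewrite -ss' -Es in Es'; rewrite (addIr _ Es').
  by case=> /addrI/oppr_inj->.
- case: pickP => [//|Ns] []; case/off => /eqP; by rewrite Ns.
- by case: pickP => [//|Ns] [/esym]; case/off => /eqP; rewrite Ns.
- by case=> /addrI/reg2/e_inj->.
- by case=> /addIr/reg2->.
- by case=> /P_row->.
Qed.

Lemma prolongation_col y : injective (prolongation^~ y).
Proof using reg2 reg3 e_inj P_col.
have off i j s : j - i <> 2%:R * e s ->
    3%:R * i - j = 2%:R * j - 6%:R * e s -> False.
  move=> ne E; case: ne; apply: reg3.
  have -> : 3%:R * (j - i) = 2%:R * j - (3%:R * i - j) by ring.
  by rewrite E; ring.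
have reg6 : injective (fun x : R => 6%:R * x).
  move=> x x' E; apply/reg2/reg3.
  by rewrite !mulrA -natrM.
case: y => [j|t] [i|s] [i'|s'] //=.
- case: pickP => [t /eqP Et|Nt]; case: pickP => [t' /eqP Et'|Nt'] //.
    by case=> tt'; rewrite -tt' -Et in Et'; rewrite (oppr_inj (addrI _ Et')).
  by case=> /addIr/reg3->.
- by case: pickP => [//|Ns] []; case/off => /eqP; rewrite Ns.
- by case: pickP => [//|Ns] [/esym]; case/off => /eqP; rewrite Ns.
- by case=> /addrI/oppr_inj/reg6/e_inj->.
- by case=> /addIr/reg2->.
- by case=> /P_col->.
Qed.

(** As no [e s] is [0], the transversals avoid the cells [(inl i, inl i)], which keep the symbols
    [2 i]. *)
Lemma prolongation_diag : injective (fun x => prolongation x x).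
Proof using reg2 e_neq0 P_diag.
have diag_inl i : prolongation (inl i) (inl i) = inl (2%:R * i).
  rewrite /prolongation; case: pickP => [s|_]; last by congr inl; ring.
  rewrite subrr -{1}(mulr0 2%:R) => /eqP/reg2/esym/eqP.
  by rewrite (negPf (e_neq0 s)).
move=> [i|s] [j|t]; rewrite ?diag_inl //=; first by case=> /reg2->.
by case=> /P_diag->.
Qed.

Lemma antidiagK : involutive antidiag.
Proof using w_inj w_nu.
case=> [i|s] /=.
  case: pickP => [s /eqP<- //|Ni] /=.
  case: pickP => [s /eqP E|_]; last by rewrite opprK.
  by have := Ni (nu s); rewrite w_nu E opprK eqxx.
case: pickP => [t /eqP/w_inj-> //|/(_ s)]; by rewrite eqxx.
Qed.

Lemma antidiag_fix x : (antidiag x == x) = (x == inl 0).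
Proof using reg2 w_neq0.
case: x => [i|s] //=; case: pickP => [s /eqP<-|_].
  by apply/esym/negbTE; apply: contra (w_neq0 s) => /eqP[->].
apply/eqP/eqP => [[E]|[->]]; last by rewrite oppr0.
congr inl; apply: reg2; rewrite mulr0.
have -> : 2%:R * i = i + i by ring.
by rewrite -{1}E addNr.
Qed.

(** Row [inl i] carries [4 i] for [i] outside the disjoint images of [e] and [w], and [inr s] for
    [i = - e s]. By [w_rho] and [w_tau], rows [inl (w s)] carry [4 e (rho s)] and rows [inr s] carry
    [4 w (tau s)], so no symbol repeats. *)
Lemma prolongation_antidiag : injective (fun x => prolongation x (antidiag x)).
Proof using reg2 e_inj w_inj tau_inj rho_inj e_neq_w e_nu w_nu w_tau w_rho.
have reg4 : injective (fun x : R => 4%:R * x).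
  by move=> x x' E; do 2!apply: reg2; rewrite !mulrA -natrM.
have inl_row s : prolongation (inr s) (inl (w s)) = inl (4%:R * w (tau s)).
  by rewrite /=; congr inl; rewrite (natrM _ 2 2) -mulrA -w_tau; ring.
have inl_col s : prolongation (inl (w s)) (inr s) = inl (4%:R * e (rho s)).
  by rewrite /=; congr inl; rewrite (natrM _ 2 2) -mulrA -w_rho; ring.
have anti i : (forall s, w s != i) ->
    (exists2 s, i = - e s & prolongation (inl i) (inl (- i)) = inr s) \/
    (forall s, e s != i) /\ prolongation (inl i) (inl (- i)) = inl (4%:R * i).
  move=> Ni /=; case: pickP => [s /eqP Es|Ns]; [left|right].
    exists s => //; apply/esym/oppr_inj/reg2; rewrite opprK -Es; ring.
  split; last by congr inl; ring.
  move=> s; apply: contraFneq (Ns (nu s)) => <-.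
  by rewrite e_nu; apply/eqP; ring.
pose theta x := prolongation x (antidiag x).
have E x : [\/ exists2 s, x = inl (w s) & theta x = inl (4%:R * e (rho s)),
    exists2 s, x = inr s & theta x = inl (4%:R * w (tau s)),
    exists2 s, x = inl (- e s) & theta x = inr s |
    exists i, [/\ x = inl i, theta x = inl (4%:R * i),
                  forall s, w s != i & forall s, e s != i]].
  rewrite /theta; case: x => [i|s]; last by apply: Or42; exists s.
  rewrite [antidiag _]/=; case: pickP => [s /eqP<-|Ni].
    by apply: Or41; exists s.
  have {}Ni s : w s != i by rewrite Ni.
  have [[s Es ->]|[Ne ->]] := anti i Ni.
    by apply: Or43; exists s; rewrite ?Es.
  by apply: Or44; exists i.
move=> x y; rewrite -/(theta x) -/(theta y).
case: (E x) => [[s -> ->]|[s -> ->]|[s -> ->]|[i [-> -> Nw Ne]]];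
  case: (E y) => [[t -> ->]|[t -> ->]|[t -> ->]|[j [-> -> Nw' Ne']]] //.
- by move=> [/reg4/e_inj/rho_inj->].
- by move=> [/reg4/eqP]; rewrite (negPf (e_neq_w _ _)).
- by move=> [/reg4/eqP]; rewrite (negPf (Ne' _)).
- by move=> [/reg4/esym/eqP]; rewrite (negPf (e_neq_w _ _)).
- by move=> [/reg4/w_inj/tau_inj->].
- by move=> [/reg4/eqP]; rewrite (negPf (Nw' _)).
- by move=> [->].
- by move=> [/reg4/esym/eqP]; rewrite (negPf (Ne _)).
- by move=> [/reg4/esym/eqP]; rewrite (negPf (Nw _)).
- by move=> [/reg4->].
Qed.


End Prolongation.

(** * From a Latin square with a subsquare to a multimagic square *)

Lemma multimagic_of_subsquare (K N : nat) (R S : finType)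
    (A : R + S -> R + S -> R + S) (sigma : R + S -> R + S) (r0 : R)
    (P : S -> S -> S) (f g : S -> nat) (s0 : S) :
  (#|R| + #|S|)%N = N ->
  involutive sigma -> (forall x, (sigma x == x) = (x == inl r0)) ->
  (forall x, injective (A x)) -> (forall y, injective (A^~ y)) ->
  injective (fun x => A x x) -> injective (fun x => A x (sigma x)) ->
  (forall s t, A (inr s) (inr t) = inr (P s t)) ->
  (forall s t, sigma (inr s) != inr t) ->
  injective f -> (forall s, f s != g s0) ->
  (forall k, (1 <= k <= K)%N -> (\sum_s f s ^ k = \sum_s g s ^ k)%N) ->
  has_nontrivial_MMS K N.
Proof.
move=> cardN sK fixE rowA colA diagA antiA A_rr anti_rr f_inj fg0 fg_pow.
have cardI : #|{: R + S}| = N by rewrite card_sum.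
have [phi phi_bij phi_rev] := antidiagonal_indexing cardI sK fixE.
have P_row s : injective (P s).
  move=> t t' E.
  by have /rowA[] : A (inr s) (inr t) = A (inr s) (inr t') by rewrite !A_rr E.
have P_col t : injective (P^~ t).
  move=> s s' E.
  by have /colA[] : A (inr s) (inr t) = A (inr s') (inr t) by rewrite !A_rr E.
have P_diag : injective (fun s => P s s).
  move=> s s' E.
  by have /diagA[] : A (inr s) (inr s) = A (inr s') (inr s') by rewrite !A_rr E.
(* The symbols outside [S] get values that avoid [f] and [g s0]. *)
pose B := (\sum_s f s + g s0).+1.
pose F (x : R + S) := match x with inl r => (B + enum_rank r)%N | inr s => f s end.
pose v x y := match x, y with inr s, inr t => g (P s t) | _, _ => F (A x y) end.
have f_lt s : (f s < B)%N by rewrite /B (bigD1 s) //=; lia.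
have F_inj : injective F.
  move=> [r|s] [r'|s'] //=.
  - by move=> /addnI/val_inj/enum_rank_inj->.
  - by move=> E; have := f_lt s'; rewrite -E; lia.
  - by move=> E; have := f_lt s; rewrite E; lia.
  - by move=> /f_inj->.
have F_neq x : F x != g s0.
  by case: x => [r|s] //=; rewrite /B; lia.
pose Z : 'M[int]_N := \matrix_(i, j) (v (phi i) (phi j))%:Z.
exists Z; split; last first.
  rewrite /trivial_square; apply/negP; rewrite -ltnNge /entry_values.
  (* Row [inl r0] misses the subsquare and so shows all [N] values of [F]; [g s0], which occurs
     inside the subsquare, is one more. *)
  pose L := g s0 :: map F (enum {: R + S}).
  have uniq_L : uniq (map Posz L).
    rewrite map_inj_uniq; last by move=> ? ? [].
    rewrite /= (map_inj_uniq F_inj) enum_uniq andbT.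
    by apply/negP => /mapP[x _ E]; have := F_neq x; rewrite E eqxx.
  have -> : N.+1 = size (map Posz L) by rewrite size_map /= size_map -cardE cardI.
  apply: uniq_leq_size => // z /mapP[n nL ->]; rewrite mem_undup.
  have entry x y : Posz (v x y) \in [seq Z p.1 p.2 | p : 'I_N * 'I_N].
    have [psi phiK psiK] := phi_bij.
    by apply/imageP; exists (psi x, psi y) => //=; rewrite mxE !psiK.
  move: nL; rewrite inE => /orP[/eqP->|/mapP[x _ ->]].
    have [Q PK QK] := injF_bij (P_row s0).
    by have := entry (inr s0) (inr (Q s0)); rewrite /= QK.
  have [Q AK QK] := injF_bij (rowA (inl r0)).
  by have := entry (inl r0) (Q x); rewrite /= QK.
move=> k kK; pose T := (\sum_x F x ^ k)%N.
(* A row, column or main diagonal meets the subsquare, if at all, in a permutation of [S], over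
   which [f] and [g] have equal power sums. *)
have gf (h : S -> S) : injective h ->
    (\sum_s g (h s) ^ k = \sum_s F (inr (h s)) ^ k)%N.
  move=> h_inj; transitivity (\sum_s g s ^ k)%N.
    by rewrite [RHS](reindex_inj h_inj).
  by rewrite -fg_pow // [LHS](reindex_inj h_inj).
have row x : (\sum_y v x y ^ k = T)%N.
  rewrite /T [RHS](reindex_inj (rowA x)); case: x => [r|s] //=.
  rewrite !big_sumType /=; congr addn; under [RHS]eq_bigr do rewrite A_rr.
  exact/gf/P_row.
have col y : (\sum_x v x y ^ k = T)%N.
  rewrite /T [RHS](reindex_inj (colA y)) !big_sumType /=; congr addn.
  case: y => [r|t] //=; under [RHS]eq_bigr do rewrite A_rr.
  exact: (gf _ (P_col t)).
have diag : (\sum_x v x x ^ k = T)%N.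
  rewrite /T [RHS](reindex_inj diagA) !big_sumType /=; congr addn.
  under [RHS]eq_bigr do rewrite A_rr.
  exact: (gf _ P_diag).
have anti : (\sum_x v x (sigma x) ^ k = T)%N.
  rewrite /T [RHS](reindex_inj antiA); apply: eq_bigr => -[r|s] _ //=.
  by case E : (sigma (inr s)) => [//|t]; have := anti_rr s t; rewrite E eqxx.
have lift (w : R + S -> nat) :
    (\sum_x w x ^ k = T)%N -> \sum_i (w (phi i))%:Z ^+ k = T%:Z.
  move=> <-; rewrite -natz natr_sum [RHS](reindex phi); last exact: onW_bij.
  by apply: eq_bigr => i _; rewrite natrX natz.
exists T%:Z; split=> [i|j||].
- under eq_bigr do rewrite !mxE; exact: (lift _ (row _)).
- under eq_bigr do rewrite !mxE; exact: (lift (v^~ _) (col _)).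
- under eq_bigr do rewrite !mxE; exact: (lift (fun x => v x x)).
- under eq_bigr do rewrite !mxE phi_rev.
  exact: (lift (fun x => v x (sigma x))).
Qed.

(** * The instance over ['Z_u] *)

Lemma intr_Zp_inj (u : nat) (a b : int) : (1 < u)%N -> (`|a - b| < u)%N ->
  a%:~R = b%:~R :> 'Z_u -> a = b.
Proof.
move=> u1 ab_u /eqP; rewrite -subr_eq0 -intrB => E.
have {E} : (`|a - b|%N)%:R == 0 :> 'Z_u.
  move: E; case: (a - b) => n //=.
  by rewrite NegzE mulrNz oppr_eq0.
rewrite -(inj_eq val_inj) /= val_Zp_nat // modn_small // absz_eq0 subr_eq0.
by move/eqP.
Qed.

(** Elements of [W] have representatives of size at most [2h + 1], so the bound on [u] keeps them
    distinct; coprimality to 6 makes 2 and 3 invertible; [1 < h] provides the subsquare of order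
    [2h]. *)
Lemma multimagic_from_equal_power_sums (K h u : nat) (f g : 'I_(2 * h) -> nat)
    (s0 : 'I_(2 * h)) :
  (1 < h)%N -> (4 * h + 3 <= u)%N -> coprime u 6 ->
  injective f -> (forall s, f s != g s0) ->
  (forall k, (1 <= k <= K)%N -> (\sum_s f s ^ k = \sum_s g s ^ k)%N) ->
  has_nontrivial_MMS K (u + 2 * h).
Proof.
move=> h1 hu u6 f_inj fg0 fg_pow.
pose S : finType := (bool * 'I_h)%type.
have cardS : #|S| = (2 * h)%N by rewrite card_prod card_bool card_ord.
have u1 : (1 < u)%N by lia.
have [P [P_row P_col P_diag]] : exists P : S -> S -> S,
    [/\ forall x, injective (P x), forall y, injective (P^~ y) &
        injective (fun x => P x x)].
  by apply: latin_square_with_transversal; rewrite cardS ?oddM //; lia.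
have [F [G FK GK]] : exists F : S -> 'I_(2 * h), bijective F.
  by apply: eq_card_bij; rewrite cardS card_ord.
pose ez (s : S) : int := (-1) ^+ s.1 * s.2.+1%:Z.
(* With [a = |ez s|], [wz s] has the opposite sign and size [2h + 2 - a]. So [wz + ez] and
   [wz - 3 ez] are even, with halves of size [h + 1 - a] and [h + 1 + a]; reversing the index sends
   [a] to [h + 1 - a], whence [rho] and [tau]. *)
pose wz (s : S) : int := - (-1) ^+ s.1 * (2 * h + 1 - s.2)%N%:Z.
pose e s : 'Z_u := (ez s)%:~R; pose w s : 'Z_u := (wz s)%:~R.
pose nu (s : S) : S := (~~ s.1, s.2).
pose tau (s : S) : S := (s.1, rev_ord s.2).
pose rho (s : S) : S := (~~ s.1, rev_ord s.2).
have reg n : coprime u n -> injective (fun x : 'Z_u => n%:R * x).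
  by move=> un; apply: mulrI; rewrite unitZpE.
have [u2 u3] : coprime u 2 /\ coprime u 3.
  by move: u6; rewrite -[6%N]/(2 * 3)%N coprimeMr => /andP.
have ez_le s : (`|ez s| <= h)%N.
  by case: s => [[] k]; have := ltn_ord k; rewrite /ez /= ?expr0 ?expr1; lia.
have wz_le s : (h + 2 <= `|wz s| <= 2 * h + 1)%N.
  by case: s => [[] k]; have := ltn_ord k; rewrite /wz /= ?expr0 ?expr1; lia.
have ez_inj : injective ez.
  move=> [[] k] [[] l]; rewrite /ez /= ?expr0 ?expr1 => E; try lia;
  by congr pair; apply: val_inj => /=; lia.
have wz_inj : injective wz.
  move=> [[] k] [[] l]; have := ltn_ord k; have := ltn_ord l;
  rewrite /wz /= ?expr0 ?expr1 => *; try lia;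
  by congr pair; apply: val_inj => /=; lia.
have e_inj : injective e.
  move=> s t /intr_Zp_inj E; apply/ez_inj/E => //.
  by have := ez_le s; have := ez_le t; lia.
have w_inj : injective w.
  move=> s t /intr_Zp_inj E; apply/wz_inj/E => //.
  by have := wz_le s; have := wz_le t; lia.
have tau_inj : injective tau.
  move=> [b k] [b' k'] E; move: (congr1 fst E) (congr1 snd E) => /= ->.
  by move/rev_ord_inj->.
have rho_inj : injective rho.
  move=> [b k] [b' k'] E; move: (congr1 fst E) (congr1 snd E) => /= /negb_inj->.
  by move/rev_ord_inj->.
have e_neq0 s : e s != 0.
  apply/eqP => /(@intr_Zp_inj u _ 0) E; have := ez_le s.
  by case: s E => [[] k] E; have {E} := E u1; rewrite /ez /= ?expr0 ?expr1; lia.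
have w_neq0 s : w s != 0.
  by apply/eqP => /(@intr_Zp_inj u _ 0) E; have := wz_le s; lia.
have e_neq_w s t : e s != w t.
  by apply/eqP => /intr_Zp_inj E; have := ez_le s; have := wz_le t; lia.
have sgN (b : bool) : (-1) ^+ (~~ b) = - (-1) ^+ b :> int by case: b.
have e_nu s : e (nu s) = - e s.
  by rewrite /e -mulrNz /ez sgN mulNr.
have w_nu s : w (nu s) = - w s.
  by rewrite /w -mulrNz /wz sgN mulNr.
have w_tau s : w s - 3%:R * e s = 2%:R * w (tau s).
  rewrite /w /e -[3%:R](rmorph_nat intr) -[2%:R](rmorph_nat intr).
  rewrite -!intrM -intrB; congr intr; case: s => b k.
  by have := ltn_ord k; rewrite /wz /ez /=; case: b; rewrite ?expr0 ?expr1; lia.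
have w_rho s : w s + e s = 2%:R * e (rho s).
  rewrite /w /e -[2%:R](rmorph_nat intr) -!intrM -intrD; congr intr.
  case: s => b k; have := ltn_ord k; rewrite /wz /ez /=.
  by case: b; rewrite /= ?expr0 ?expr1; lia.
apply: (@multimagic_of_subsquare _ _ 'Z_u S (prolongation e P) (antidiag w) 0 P
          (f \o F) (g \o F) (G s0)).
- by rewrite cardS card_ord Zp_cast.
- exact: antidiagK w_inj w_nu.
- exact: antidiag_fix (reg _ u2) w_neq0.
- exact: prolongation_row (reg _ u2) e_inj e_nu P_row.
- exact: prolongation_col (reg _ u2) (reg _ u3) e_inj P_col.
- exact: prolongation_diag (reg _ u2) e_neq0 P_diag.
- exact: prolongation_antidiag (reg _ u2) e_inj w_inj tau_inj rho_inj e_neq_w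
    e_nu w_nu w_tau w_rho.
- by [].
- by [].
- by apply: inj_comp f_inj (can_inj FK).
- by move=> s; rewrite /= GK.
- move=> k kK /=; move: (fg_pow k kK).
  rewrite [X in X = _ -> _](reindex F) ?[X in _ = X -> _](reindex F) //.
  + by apply: onW_bij; exists G.
  + by apply: onW_bij; exists G.
Qed.

(** * The orders 13 and 25 *)

(* Up to permuting rows and columns, block diagonal with Latin squares on the sets
   {1,3,6,8,16}, {2,7,12,13} and {4,5,10,15}, whose sums and sums of squares are
   all 34 and 366. *)
Definition bimagic13 : seq (seq nat) :=
  [:: [:: 0; 0; 2; 7; 0; 0; 0; 0; 0; 12; 13; 0; 0];
      [:: 0; 0; 7; 12; 0; 0; 0; 0; 0; 13; 2; 0; 0];
      [:: 4; 5; 0; 0; 0; 0; 0; 0; 0; 0; 0; 10; 15];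
      [:: 5; 10; 0; 0; 0; 0; 0; 0; 0; 0; 0; 15; 4];
      [:: 0; 0; 0; 0; 1; 6; 16; 3; 8; 0; 0; 0; 0];
      [:: 0; 0; 0; 0; 3; 8; 1; 6; 16; 0; 0; 0; 0];
      [:: 0; 0; 0; 0; 6; 16; 3; 8; 1; 0; 0; 0; 0];
      [:: 0; 0; 0; 0; 8; 1; 6; 16; 3; 0; 0; 0; 0];
      [:: 0; 0; 0; 0; 16; 3; 8; 1; 6; 0; 0; 0; 0];
      [:: 10; 15; 0; 0; 0; 0; 0; 0; 0; 0; 0; 4; 5];
      [:: 15; 4; 0; 0; 0; 0; 0; 0; 0; 0; 0; 5; 10];
      [:: 0; 0; 12; 13; 0; 0; 0; 0; 0; 2; 7; 0; 0];
      [:: 0; 0; 13; 2; 0; 0; 0; 0; 0; 7; 12; 0; 0]]%N.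

Lemma multimagic_2_13 : has_nontrivial_MMS 2 13.
Proof.
pose t i j := nth 0%N (nth [::] bimagic13 i) j.
pose sums (F : nat -> nat) := (sumn [seq F i ^ 1 | i <- iota 0 13] == 34)%N
  && (sumn [seq F i ^ 2 | i <- iota 0 13] == 366)%N.
exists (\matrix_(i, j) (t i j)%:Z); split.
  move=> k k12; exists (if k == 1%N then 34 else 366)%N%:Z.
  have line (F : nat -> nat) : sums F ->
      \sum_(i < 13) (F i)%:Z ^+ k = (if k == 1%N then 34 else 366)%N%:Z.
    case/andP=> /eqP F1 /eqP F2.
    have <- : sumn [seq F i ^ k | i <- iota 0 13]%N =
        (if k == 1 then 34 else 366)%N.
      by case: k k12 => [|[|[|k]]].
    rewrite sumnE big_map -natz natr_sum -[iota 0 13]/(index_iota 0 13) big_mkord.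
    by apply: eq_bigr => i _; rewrite natrX natz.
  have rows : all (fun i => sums (t i)) (iota 0 13) by vm_compute.
  have cols : all (fun j => sums (t^~ j)) (iota 0 13) by vm_compute.
  split=> [i|j||].
  - under eq_bigr do rewrite !mxE; apply: (line (t i)).
    by apply: (allP rows); rewrite mem_iota /= ltn_ord.
  - under eq_bigr do rewrite !mxE; apply: (line (t^~ j)).
    by apply: (allP cols); rewrite mem_iota /= ltn_ord.
  - under eq_bigr do rewrite !mxE; apply: (line (fun i => t i i)).
    by vm_compute.
  - under eq_bigr do rewrite !mxE; apply: (line (fun i => t i (13 - i.+1)%N)).
    by vm_compute.
apply/negP; rewrite -ltnNge.
(* The thirteen block symbols and the filler [0]: one value more than the order. *)
pose vals := [:: 0; 1; 2; 3; 4; 5; 6; 7; 8; 10; 12; 13; 15; 16]%N.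
have vals_t : all (fun n => has (fun i => has (fun j => t i j == n) (iota 0 13))
    (iota 0 13)) vals by vm_compute.
rewrite -[14%N]/(size (map Posz vals)); apply: uniq_leq_size.
  by rewrite map_inj_uniq // => ? ? [].
move=> _ /mapP[n /(allP vals_t)/hasP[i + /hasP[j + /eqP<-]] ->].
rewrite !mem_iota /= => i13 j13; rewrite mem_undup.
by apply/imageP; exists (Ordinal i13, Ordinal j13); rewrite //= mxE.
Qed.

(* With the Prouhet-Tarry-Escott pair {0,4,7,11}, {1,2,9,10}, padded to size 6. *)
Lemma multimagic_3_25 : has_nontrivial_MMS 3 25.
Proof.
pose f (s : 'I_(2 * 3)) := nth 0%N [:: 0; 4; 7; 11; 20; 21]%N s.
pose g (s : 'I_(2 * 3)) := nth 0%N [:: 1; 2; 9; 10; 20; 21]%N s.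
apply: (@multimagic_from_equal_power_sums 3 3 19 f g ord0) => //.
- move=> s t /eqP; rewrite nth_uniq // => /eqP; exact: val_inj.
- by case=> [[|[|[|[|[|[|s]]]]]] ls].
- by case=> [|[|[|[|k]]]] // _; rewrite !(big_ord_recl, big_ord0).
Qed.

(** * The choice of [h] and the bound for all [K] *)

Lemma has_nontrivial_MMS_small_order (K : nat) : (2 <= K)%N ->
  has_nontrivial_MMS K (2 * K * (K + 1) + 1).
Proof.
move=> K2; case: (ltngtP K 3) => [K3|K3|->]; last exact: multimagic_3_25.
  have -> : K = 2 by lia.
  exact: multimagic_2_13.
pose n := 'C(K.+1, 2).
have n2 : (2 * n = K * K.+1)%N.
  by rewrite /n mul_bin_left bin1 subn1.
have n_ge : n = 10 \/ (15 <= n)%N.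
  have [K4|K5] : K = 4 \/ (5 <= K)%N by lia.
    by left; move: n2; rewrite K4; lia.
  by right; nia.
(* Here [u = 4n + 1 - 2h]. The next [h] lowers [u] by 2, so one of the two smallest candidates makes
   [u] prime to 3. The second fits when [15 <= n]; for [n = 10] the first gives [u = 29]. *)
have [h [h_gt h_lt h3]] : exists h, [/\ (n < 2 * h)%N,
    (6 * h + 3 <= 4 * n + 1)%N & ~~ (3 %| 4 * n + 1 - 2 * h)%N].
  have [H|/negPn H] := boolP (~~ (3 %| 4 * n + 1 - 2 * (n %/ 2).+1))%N.
    by exists (n %/ 2).+1; split=> //; case: n_ge => E; lia.
  by exists (n %/ 2).+2; split; case: n_ge => E; lia.
have [f [g [f_inj [s0 fg0] fg_pow]]] := equal_power_sums h_gt.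
have -> : (2 * K * (K + 1) + 1 = (4 * n + 1 - 2 * h) + 2 * h)%N by nia.
apply: (multimagic_from_equal_power_sums _ _ _ f_inj fg0 fg_pow); try lia.
rewrite -[6%N]/(2 * 3)%N coprimeMr coprimen2 [coprime _ 3]coprime_sym.
by rewrite prime_coprime // h3 andbT; lia.
Qed.

Theorem theorem1 (K : nat) (hK : (2 <= K)%N) :
  (exists n : nat, is_N2 K n /\ (n <= 2 * K * (K + 1) + 1)%N) /\
  has_nontrivial_MMS K (2 * K * (K + 1) + 1)%N.
Proof.
have Hbound := has_nontrivial_MMS_small_order hK; split=> //.
set N := (2 * K * (K + 1) + 1)%N in Hbound *.
have N_gt0 : (0 < N)%N by rewrite /N addn1.
(* No decision procedure for the existence of a square is at hand, so the least order is reached by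
   descent from the bound with excluded middle. *)
elim/ltn_ind: N N_gt0 Hbound => N IH N_gt0 HN.
have [[m [m_lt m_gt0 Hm]]|no] := classic (exists m,
    [/\ (m < N)%N, (0 < m)%N & has_nontrivial_MMS K m]).
  have [n [Hn n_le]] := IH m m_lt m_gt0 Hm.
  by exists n; split=> //; apply: leq_trans n_le (ltnW m_lt).
exists N; split=> //; split=> // m m_gt0 Hm; rewrite leqNgt.
by apply/negP => m_lt; apply: no; exists m.
Qed.
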